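(* Let $f(\mathbf{x}) \in \mathbb{R}[x_1,\dots,x_n]$ be a determinantal polynomial of degree $d$, so that $f(\mathbf{x}) = \det(I + x_1A_1 + \dots + x_nA_n)$ for some $d\times d$ symmetric (or Hermitian) matrices $A_1,\dots,A_n$. Then the coefficients of $f$ are uniquely determined by the generalized mixed discriminants of the coefficient matrices $A_i$ as follows: for every monomial $x_1^{k_1}x_2^{k_2}\cdots x_n^{k_n}$ of degree $k = k_1+\dots+k_n$ with $1\le k \leq d$, the coefficient $f_{k_1\dots k_n}$ of $x_1^{k_1}\cdots x_n^{k_n}$ in $f$ is $$f_{k_1\dots k_n} = \widehat{D}(\underbrace{A_1,\dots,A_1}_{k_1},\underbrace{A_2,\dots,A_2}_{k_2},\dots,\underbrace{A_n,\dots,A_n}_{k_n}).$$ In particular: (1) $\mathrm{Tr}\, A_i$ equals the coefficient of $x_i$ in $f$ for all $i=1,\dots,n$; (2) $\det A_i$ equals the coefficient of $x_i^d$ in $f$ for all $i=1,\dots,n$, where $d$, the degree of the polynomial, is equal to the size of the coefficient matrices.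
   Context: Generalized mixed discriminant (GMD): let $A_1,\dots,A_m$ be $d\times d$ matrices, $A_l = (a^{(l)}_{ij})$, and let $\mu_1,\dots,\mu_m$ be non-negative integers with $\mu_1+\dots+\mu_m=k$, $1\le k\le d$. Define $$\widehat{D}(\underbrace{A_1,\dots,A_1}_{\mu_1},\dots,\underbrace{A_m,\dots,A_m}_{\mu_m}) = \sum_{\alpha\in S[k]}\ \sum_{\sigma\in\widehat{S_k}(v)} \det\begin{bmatrix} a^{(\sigma(1))}_{\alpha_1\alpha_1} & \dots & a^{(\sigma(1))}_{\alpha_1\alpha_k}\\ \vdots & & \vdots\\ a^{(\sigma(k))}_{\alpha_k\alpha_1} & \dots & a^{(\sigma(k))}_{\alpha_k\alpha_k}\end{bmatrix},$$ where $S[k]$ is the set of all $\alpha=(\alpha_1,\dots,\alpha_k)$ with $1\le\alpha_1<\alpha_2<\dots<\alpha_k\le d$, $v$ is the multiset $\{\underbrace{1,\dots,1}_{\mu_1},\dots,\underbrace{m,\dots,m}_{\mu_m}\}$, and $\widehat{S_k}(v)$ is the set of all distinct permutations (arrangements) $\sigma=(\sigma(1),\dots,\sigma(k))$ of $v$. The matrices need not be distinct. *)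

(* Defs.v *)
From HB Require Import structures.
From mathcomp Require Import all_boot all_order all_algebra.
From mathcomp Require Import reals.
From mathcomp Require Export complex mpoly.

Set Implicit Arguments.
Unset Strict Implicit.
Unset Printing Implicit Defensive.

Import GRing.Theory.
Local Open Scope ring_scope.

Definition increasing_tuples (d k : nat) : {set k.-tuple 'I_d} :=
  [set alpha : k.-tuple 'I_d | sorted ltn [seq val i | i <- alpha]].

(* The multiset v = {1,...,1 (mu_1 times), ..., m,...,m (mu_m times)}, listed
   in increasing order; its members are indexed from 0. *)
Definition repeated_indices (m : nat) (mu : 'I_m -> nat) : seq 'I_m :=
  flatten [seq nseq (mu l) l | l <- enum 'I_m].

(* The set contains each arrangement of v once, whatever the multiplicities. *)
Definition arrangements (m : nat) (mu : 'I_m -> nat) (k : nat) :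
    {set k.-tuple 'I_m} :=
  [set sigma : k.-tuple 'I_m | perm_eq sigma (repeated_indices mu)].

(* The order k of the minors is the sum of the multiplicities.  The source
   restricts to 1 <= k <= d; the formula is left total here. *)
Definition gmd (R : comNzRingType) (d m : nat)
    (A : 'I_m -> 'M[R]_d) (mu : 'I_m -> nat) : R :=
  let k := (\sum_(l < m) mu l)%N in
  \sum_(alpha in increasing_tuples d k)
    \sum_(sigma in arrangements mu k)
      \det (\matrix_(i < k, j < k)
              A (tnth sigma i) (tnth alpha i) (tnth alpha j)).

Definition linear_pencil (R : comNzRingType) (n d : nat)
    (A : 'I_n -> 'M[R]_d) : 'M[{mpoly R[n]}]_d :=
  1%:M + \sum_(i < n) 'X_i *: map_mx (@mpolyC n R) (A i).

(* Main.v *)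
Require Import Defs.
From HB Require Import structures.
From mathcomp Require Import all_boot all_order all_algebra.
From mathcomp Require Import reals complex mpoly.

Set Implicit Arguments.
Unset Strict Implicit.
Unset Printing Implicit Defensive.

Import Order.TTheory GRing.Theory Num.Theory.
Local Open Scope ring_scope.
Local Open Scope complex_scope.

(** Row [x] of the pencil [1 + X_0 A_0 + ... + X_(n-1) A_(n-1)] is a sum of
    [n + 1] rows: the unit row [e_x], and ['X_l] times row [x] of [A l] for each
    [l].  By multilinearity in the rows, the determinant is a sum over the
    functions [g : 'I_d -> option 'I_n] that choose one summand in each row
    ([None] stands for the unit row).  The term of [g] is a monomial, the number
    of [x] with [g x = Some l] being the exponent of ['X_l], times the
    determinant of the scalar matrix of the chosen rows
    ([det_linear_pencil]).  So the coefficient at [mu] is the sum of these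
    determinants over the [g] of content [mu].

    That sum is the generalized mixed discriminant.  Listing the support of [g]
    increasingly as [alpha], and its values along [alpha] as [sigma], gives a
    bijection between the [g] of content [mu] and the pairs of an increasing
    tuple and an arrangement of the multiset [mu] ([gmd_sum_row_choices]).
    Outside the support the chosen rows are unit rows, so the determinant of
    the [d] chosen rows equals its principal minor on [alpha]
    ([det_choice_of_minor]), which is the summand of the discriminant.

    When only one index is repeated, there is one arrangement, and the
    discriminant is the sum of the principal minors of that order of one matrix
    ([gmd_repeated]): the trace for order [1], the determinant for order [d].

    The real and Hermitian cases are the instances of
    [mcoeff_det_linear_pencil] at [R] and at [R[i]]. *)

(** * Determinants with unit rows *)

(** The two sides are the determinants obtained by eliminating either
    off-diagonal block of [[1, -U; V, 1]] (Sylvester's identity). *)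
Lemma det_add1_mulmxC (R : comNzRingType) (p q : nat)
    (U : 'M[R]_(p, q)) (V : 'M[R]_(q, p)) :
  \det (1%:M + U *m V) = \det (1%:M + V *m U).
Proof.
pose L := block_mx 1%:M (- U) V 1%:M : 'M_(p + q).
have LU : block_mx 1%:M U 0 1%:M *m L = block_mx (1%:M + U *m V) 0 V 1%:M.
  by rewrite mulmx_block !mul1mx !mul0mx !mulmx1 !add0r addNr.
have UL : L *m block_mx 1%:M U 0 1%:M = block_mx 1%:M 0 V (1%:M + V *m U).
  by rewrite mulmx_block !mulmx1 !mulmx0 !mul1mx !addr0 subrr addrC.
have detL : \det L = \det (1%:M + U *m V).
  by have := congr1 determinant LU;
     rewrite det_mulmx det_ublock det_lblock !det1 !mul1r mulr1.
by have := congr1 determinant UL;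
   rewrite det_mulmx det_ublock det_lblock !det1 !mulr1 mul1r -detL.
Qed.

(** With [P] the selection matrix of [h], [P P^T = 1], and [B - 1] vanishes
    outside the rows selected by [h], so [B = 1 + P^T P (B - 1)].  Sylvester's
    identity then moves [P^T] to the right and leaves [P B P^T], the minor. *)
Lemma det_unit_rows (R : comNzRingType) (d k : nat) (B : 'M[R]_d)
    (h : 'I_k -> 'I_d) :
  injective h ->
  (forall x, x \notin codom h -> row x B = row x 1%:M) ->
  \det B = \det (mxsub h h B).
Proof.
move=> injh rowB; pose P : 'M[R]_(k, d) := rowsub h 1%:M.
have PB q (C : 'M[R]_(d, q)) : P *m C = rowsub h C.
  by rewrite mul_rowsub_mx mul1mx.
have PP : P *m P^T = 1%:M.
  by apply/matrixP=> i j; rewrite PB !mxE eq_sym (inj_eq injh).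
have defB : B = 1%:M + P^T *m (P *m (B - 1%:M)).
  rewrite -[LHS](subrK 1%:M) addrC; congr (_ + _).
  apply/matrixP=> x y; rewrite [in RHS]mxE.
  have [/codomP[i ->]|hx] := boolP (x \in codom h).
    rewrite (bigD1 i) //= PB !mxE eqxx mul1r big1 ?addr0 // => j ji.
    by rewrite !mxE (inj_eq injh) (negPf ji) mul0r.
  rewrite big1 => [|i _]; last first.
    rewrite !mxE; case: eqP => [xh|]; last by rewrite mul0r.
    by rewrite -xh codom_f in hx.
  by have /rowP/(_ y) := rowB x hx; rewrite !mxE => ->; rewrite subrr.
rewrite [in LHS]defB det_add1_mulmxC -mulmxA mulmxBl mul1mx mulmxBr PP.
rewrite addrC subrK; congr (\det _).
rewrite mulmxA PB; have -> : P^T = colsub h 1%:M.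
  by apply/matrixP=> i j; rewrite !mxE eq_sym.
by rewrite mulmx_colsub mulmx1 -mxsub_comp.
Qed.

(** * The determinant of the pencil as a sum over row choices *)

Definition row_choice_mx (R : comNzRingType) (n d : nat)
    (A : 'I_n -> 'M[R]_d) (g : 'I_d -> option 'I_n) : 'M[R]_d :=
  \matrix_(x, y) if g x is Some l then A l x y else (x == y)%:R.

Definition content (n d : nat) (g : 'I_d -> option 'I_n) : 'X_{1..n} :=
  [multinom #|[pred x | g x == Some l]| | l < n].

Lemma prod_choice_monomials (R : comNzRingType) (n d : nat)
    (g : 'I_d -> option 'I_n) :
  \prod_x (if g x is Some l then 'X_l else 1) = 'X_[content g]
    :> {mpoly R[n]}.
Proof.
pose m x : 'X_{1..n} := if g x is Some l then U_(l)%MM else 0%MM.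
rewrite (eq_bigr (fun x => 'X_[m x])) => [|x _]; last first.
  by rewrite /m; case: (g x) => // ; rewrite mpolyX0.
rewrite mprodXE; congr 'X_[_]; apply/mnmP=> l.
rewrite mnm_sumE mnmE -sum1_card [in RHS]big_mkcond /=; apply: eq_bigr => x _.
rewrite /m inE; case: (g x) => [j|]; last by rewrite mnm0E.
by rewrite mnm1E (inj_eq Some_inj); case: eqP.
Qed.

Lemma sum_option (V : nmodType) (T : finType) (F : option T -> V) :
  \sum_o F o = F None + \sum_t F (Some t).
Proof.
rewrite (bigD1 None) //= (reindex_omap Some id) => [|[]//].
by congr (_ + _); apply: eq_bigl => t; rewrite eqxx.
Qed.

(** The expansion by multilinearity in the rows: [bigA_distr_bigA] distributes
    the product over rows inside the Leibniz formula, and a diagonal factor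
    collects the variables of each choice. *)
Lemma det_linear_pencil (R : comNzRingType) (n d : nat)
    (A : 'I_n -> 'M[R]_d) :
  \det (linear_pencil A) =
  \sum_(g : {ffun 'I_d -> option 'I_n})
     \det (row_choice_mx A g) *: 'X_[content g].
Proof.
pose F (x : 'I_d) (o : option 'I_n) (y : 'I_d) : {mpoly R[n]} :=
  (if o is Some l then 'X_l else 1) *
  (if o is Some l then A l x y else (x == y)%:R)%:MP.
have pencilE x y : linear_pencil A x y = \sum_o F x o y.
  rewrite sum_option /linear_pencil !mxE summxE /F mul1r; congr (_ + _).
    by rewrite rmorph_nat.
  by apply: eq_bigr => l _; rewrite !mxE.
transitivity (\sum_(g : {ffun 'I_d -> option 'I_n})
                \det (\matrix_(x, y) F x (g x) y)).
  rewrite exchange_big; apply: eq_bigr => s _ /=.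
  rewrite -mulr_sumr; congr (_ * _).
  under eq_bigr do rewrite pencilE.
  rewrite bigA_distr_bigA; apply: eq_bigr => g _.
  by apply: eq_bigr => x _; rewrite mxE.
apply: eq_bigr => g _.
pose D := \row_x (if g x is Some l then 'X_l else 1) : 'rV[{mpoly R[n]}]_d.
have -> : \matrix_(x, y) F x (g x) y =
          diag_mx D *m map_mx (@mpolyC n R) (row_choice_mx A g).
  by rewrite mul_diag_mx; apply/matrixP=> x y; rewrite !mxE.
rewrite det_mulmx det_diag det_map_mx mulrC mul_mpolyC; congr (_ *: _).
by rewrite -prod_choice_monomials; apply: eq_bigr => x _; rewrite mxE.
Qed.

(** * Row choices as pairs of a minor and an arrangement *)

Lemma mem_arrangements (m k : nat) (mu : 'I_m -> nat) (sigma : k.-tuple 'I_m) :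
  reflect (forall l, count_mem l sigma = mu l) (sigma \in arrangements mu k).
Proof.
have countE l : count_mem l (repeated_indices mu) = mu l.
  rewrite count_flatten -map_comp sumnE big_map big_enum /=.
  rewrite (bigD1 l) //= count_nseq /= eqxx mul1n big1 ?addn0 // => j jl.
  by rewrite count_nseq /= (negPf jl).
rewrite inE; apply: (iffP idP) => [/permP eq_count l|eq_count].
  by rewrite eq_count countE.
by apply/allP=> l _; rewrite /= countE eq_count eqxx.
Qed.

(** [pick] inverts [tnth p.1]: the position that it finds is unique when the
    entries of [p.1] are distinct, in particular when they increase. *)
Definition choice_of_minor (n d k : nat)
    (p : k.-tuple 'I_d * k.-tuple 'I_n) : {ffun 'I_d -> option 'I_n} :=
  [ffun x => omap (tnth p.2) [pick i | tnth p.1 i == x]].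

Lemma increasing_tnth_inj (d k : nat) (alpha : k.-tuple 'I_d) :
  alpha \in increasing_tuples d k -> injective (tnth alpha).
Proof.
rewrite inE => incr; apply/tuple_uniqP; rewrite -(map_inj_uniq val_inj).
exact: (sorted_uniq ltn_trans ltnn).
Qed.

Lemma choice_of_minor_tnth (n d k : nat) (alpha : k.-tuple 'I_d)
    (sigma : k.-tuple 'I_n) (i : 'I_k) :
  injective (tnth alpha) ->
  choice_of_minor (alpha, sigma) (tnth alpha i) = Some (tnth sigma i).
Proof.
move=> inj; rewrite ffunE /=; case: pickP => [j /eqP/inj -> //|/(_ i)].
by rewrite eqxx.
Qed.

Lemma choice_of_minor_support (n d k : nat) (alpha : k.-tuple 'I_d)
    (sigma : k.-tuple 'I_n) (x : 'I_d) :
  isSome (choice_of_minor (alpha, sigma) x) = (x \in alpha).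
Proof.
rewrite ffunE /=; case: pickP => [i /eqP <-|alpha'x] /=.
  by rewrite mem_tnth.
by apply/esym/negP => /tnthP[i xi]; have := alpha'x i; rewrite xi eqxx.
Qed.

Lemma content_choice_of_minor (n d k : nat) (alpha : k.-tuple 'I_d)
    (sigma : k.-tuple 'I_n) (l : 'I_n) :
  injective (tnth alpha) ->
  content (choice_of_minor (alpha, sigma)) l = count_mem l sigma.
Proof.
move=> inj; transitivity #|[pred i | tnth sigma i == l]|; last first.
  rewrite -[in RHS](map_tnth_enum sigma) count_map enumT.
  by rewrite cardE /enum_mem size_filter.
rewrite mnmE -(card_image inj); apply: eq_card => x; rewrite inE.
apply/eqP/imageP => [gx|[i /eqP il ->]]; last first.
  by rewrite choice_of_minor_tnth // il.
have /tnthP[i xi] : x \in alpha.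
  by rewrite -(choice_of_minor_support _ sigma) gx.
exists i => //; move: gx; rewrite xi choice_of_minor_tnth // => -[<-].
by rewrite inE.
Qed.

Lemma det_choice_of_minor (R : comNzRingType) (n d k : nat)
    (A : 'I_n -> 'M[R]_d) (alpha : k.-tuple 'I_d) (sigma : k.-tuple 'I_n) :
  injective (tnth alpha) ->
  \det (row_choice_mx A (choice_of_minor (alpha, sigma))) =
  \det (\matrix_(i < k, j < k)
          A (tnth sigma i) (tnth alpha i) (tnth alpha j)).
Proof.
move=> inj; rewrite (det_unit_rows inj) => [|x alpha'x].
  congr (\det _); apply/matrixP=> i j.
  by rewrite !mxE choice_of_minor_tnth.
apply/rowP=> y; rewrite !mxE; case Egx: (choice_of_minor _ x) => [l|//].
have /tnthP[i xi] : x \in alpha.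
  by rewrite -(choice_of_minor_support _ sigma) Egx.
by rewrite xi codom_f in alpha'x.
Qed.

Lemma increasing_tuples_eq (d k : nat) (alpha beta : k.-tuple 'I_d) :
  alpha \in increasing_tuples d k -> beta \in increasing_tuples d k ->
  alpha =i beta -> alpha = beta.
Proof.
rewrite !inE !sorted_map => incr_a incr_b eq_ab; apply/val_inj.
apply: irr_sorted_eq incr_a incr_b eq_ab => [y x z|x]; first exact: ltn_trans.
exact: ltnn.
Qed.

(** The index pairs of [gmd] are reindexed along [choice_of_minor], which is
    injective on them (a choice determines its support, hence its increasing
    listing, and then the values along it) and reaches every choice of content
    [mu]. *)
Lemma gmd_sum_row_choices (R : comNzRingType) (n d : nat)
    (A : 'I_n -> 'M[R]_d) (mu : 'X_{1..n}) :
  gmd A mu =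
  \sum_(g : {ffun 'I_d -> option 'I_n} | content g == mu)
     \det (row_choice_mx A g).
Proof.
rewrite /gmd; set k := (\sum_(l < n) mu l)%N.
pose D := setX (increasing_tuples d k) (arrangements mu k).
have DP alpha sigma : (alpha, sigma) \in D ->
    [/\ alpha \in increasing_tuples d k, injective (tnth alpha)
      & content (choice_of_minor (alpha, sigma)) = mu].
  rewrite inE /= => /andP[incr /mem_arrangements count_sigma].
  have inj := increasing_tnth_inj incr; split=> //.
  by apply/mnmP=> l; rewrite content_choice_of_minor.
have injD : {in D &, injective (@choice_of_minor n d k)}.
  move=> [alpha sigma] [beta tau] /DP[incr_a inj_a _] /DP[incr_b _ _] eq_g.
  have eq_ab : alpha = beta.
    apply: increasing_tuples_eq => // x.
    by rewrite -(choice_of_minor_support _ sigma) eq_g choice_of_minor_support.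
  rewrite -{beta incr_b}eq_ab in eq_g *.
  suff -> : sigma = tau by []; apply: eq_from_tnth => i.
  have /ffunP/(_ (tnth alpha i)) := eq_g.
  by rewrite !choice_of_minor_tnth // => -[].
have imD : [set choice_of_minor p | p in D] =i
    [pred g : {ffun 'I_d -> option 'I_n} | content g == mu].
  move=> g; rewrite inE; apply/imsetP/eqP.
    by case=> -[alpha sigma] /DP[_ _ <-] ->.
  move=> cg.
  (* Each index of the support has exactly one value, so summing the content
     over the values counts the support: its size is the order of the minors. *)
  have size_supp : size (enum [pred x | isSome (g x)]) == k.
    rewrite -cardE -sum1_card big_mkcond /k -cg /=.
    under [X in _ == X]eq_bigr do rewrite mnmE -sum1_card big_mkcond /=.
    rewrite exchange_big /=; apply/eqP/eq_bigr => x _.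
    under [RHS]eq_bigr do rewrite inE.
    rewrite inE.
    case: (g x) => [l|] /=; last by rewrite big1.
    rewrite (bigD1 l) //= eqxx big1 // => j jl.
    by rewrite (inj_eq Some_inj) eq_sym (negPf jl).
  pose alpha : k.-tuple 'I_d := Tuple size_supp.
  have mem_alpha x : (x \in alpha) = isSome (g x) by rewrite mem_enum inE.
  have incr : alpha \in increasing_tuples d k.
    rewrite inE sorted_map /= /enum_mem; apply: sorted_filter.
      by move=> y x z; apply: ltn_trans.
    by rewrite -enumT -sorted_map val_enum_ord iota_ltn_sorted.
  have inj := increasing_tnth_inj incr.
  have [s gs] : exists s : 'I_k -> 'I_n,
      forall i, g (tnth alpha i) = Some (s i).
    apply: (@fin_all_exists _ _
      (fun i l => g (tnth alpha i) = Some l)) => i.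
    have := mem_tnth i alpha.
    by rewrite mem_alpha; case: (g _) => // l _; exists l.
  pose sigma := [tuple s i | i < k].
  have def_g : g = choice_of_minor (alpha, sigma).
    apply/ffunP=> x; have [/tnthP[i ->]|alpha'x] := boolP (x \in alpha).
      by rewrite choice_of_minor_tnth // gs tnth_mktuple.
    have := alpha'x; rewrite mem_alpha; case: (g x) => // _.
    move: alpha'x; rewrite -(choice_of_minor_support _ sigma).
    by case: (choice_of_minor _ x).
  exists (alpha, sigma) => //; rewrite inE incr /=.
  apply/mem_arrangements => l.
  by rewrite -(content_choice_of_minor _ l inj) -def_g cg.
rewrite -(eq_bigl _ _ imD) big_imset //= pair_big_dep /=.
apply: eq_big => [[alpha sigma]|[alpha sigma] /andP[incr _] /=].
  by rewrite in_setX.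
by rewrite det_choice_of_minor //; apply: increasing_tnth_inj.
Qed.

(** * Coefficients of determinantal polynomials *)

(** This also covers the constant term, where both sides are [1], and degrees
    above [d], where no increasing tuple exists and both sides vanish. *)
Lemma mcoeff_det_linear_pencil (R : comNzRingType) (n d : nat)
    (A : 'I_n -> 'M[R]_d) (mu : 'X_{1..n}) :
  (\det (linear_pencil A))@_mu = gmd A mu.
Proof.
rewrite det_linear_pencil raddf_sum gmd_sum_row_choices [RHS]big_mkcond /=.
apply: eq_bigr => g _; rewrite mcoeffZ mcoeffX.
by case: eqP; rewrite ?mulr1 ?mulr0.
Qed.

(** The only arrangement of [c] copies of [l] is the constant word. *)
Lemma gmd_repeated (R : comNzRingType) (n d c : nat)
    (A : 'I_n -> 'M[R]_d) (l : 'I_n) :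
  gmd A (U_(l) *+ c)%MM =
  \sum_(alpha in increasing_tuples d c)
    \det (mxsub (tnth alpha) (tnth alpha) (A l)).
Proof.
(* The order of the minors occurs in the types of the index tuples: it has to
   be abstracted before it can be replaced by [c]. *)
rewrite /gmd; have: (\sum_(j < n) (U_(l) *+ c)%MM j = c)%N.
  by rewrite -mdegE mdegMn mdeg1 mul1n.
move: (\sum_(j < n) _)%N => k ->; apply: eq_bigr => alpha _.
rewrite (big_pred1 (nseq_tuple c l)) => [|sigma /=].
  by congr (\det _); apply/matrixP=> i j; rewrite !mxE tnth_nseq.
apply/mem_arrangements/eqP => [count_sigma|-> j].
  apply: eq_from_tnth => i; rewrite tnth_nseq.
  have: all (pred1 l) sigma.
    by rewrite all_count count_sigma mulmnE mnm1E eqxx mul1n size_tuple.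
  by move/all_tnthP/(_ i)/eqP.
by rewrite count_nseq mulmnE mnm1E /=.
Qed.

Lemma gmd_single (R : comNzRingType) (n d : nat)
    (A : 'I_n -> 'M[R]_d) (l : 'I_n) :
  gmd A U_(l)%MM = \tr (A l).
Proof.
have -> : U_(l)%MM = (U_(l) *+ 1)%MM by apply/mnmP=> j; rewrite mulmnE muln1.
rewrite gmd_repeated /mxtrace (reindex (fun x => [tuple x])); last first.
  exists (@thead 0 'I_d) => [x _ | alpha _]; first by rewrite theadE.
  by case/tupleP: alpha => x t; apply: val_inj; rewrite /= theadE (tuple0 t).
apply: eq_big => [x|x _]; first by rewrite inE.
by rewrite det_mx11 !mxE.
Qed.

(** An injective self-map of ['I_d] is onto, so the only increasing [d]-tuple of
    ['I_d] is the enumeration, and the only minor of order [d] is the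
    determinant. *)
Lemma gmd_full (R : comNzRingType) (n d : nat)
    (A : 'I_n -> 'M[R]_d) (l : 'I_n) :
  gmd A (U_(l) *+ d)%MM = \det (A l).
Proof.
rewrite gmd_repeated.
have incr_ord : ord_tuple d \in increasing_tuples d d.
  by rewrite inE val_ord_tuple val_enum_ord iota_ltn_sorted.
rewrite (big_pred1 (ord_tuple d)) => [|alpha /=].
  by congr (\det _); apply/matrixP=> i j; rewrite !mxE !tnth_ord_tuple.
apply/idP/eqP => [incr|->//]; apply: increasing_tuples_eq => // x.
have -> : x \in ord_tuple d by apply/tnthP; exists x; rewrite tnth_ord_tuple.
have inj := increasing_tnth_inj incr.
have /codomP[i ->] : x \in codom (tnth alpha).
  by have [h _ hK] := injF_bij inj; rewrite -(hK x) codom_f.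
exact: mem_tnth.
Qed.

Theorem theorem2p5 (R : realType) (n d : nat) (f : {mpoly R[n]})
    (deg_f : msize f = d.+1) :
  (forall A : 'I_n -> 'M[R]_d,
     (forall i, A i \is symmetricmx) ->
     f = \det (linear_pencil A) ->
     [/\ forall k : 'X_{1..n}, (1 <= mdeg k <= d)%N -> f@_k = gmd A k,
         forall i : 'I_n, \tr (A i) = f@_U_(i)
       & forall i : 'I_n, \det (A i) = f@_(U_(i) *+ d)])
  /\
  (forall A : 'I_n -> 'M[R[i]]_d,
     (forall i, A i \is hermsymmx) ->
     map_mpoly (real_complex R) f = \det (linear_pencil A) ->
     [/\ forall k : 'X_{1..n}, (1 <= mdeg k <= d)%N -> (f@_k)%:C = gmd A k,
         forall i : 'I_n, \tr (A i) = (f@_U_(i))%:C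
       & forall i : 'I_n, \det (A i) = (f@_(U_(i) *+ d))%:C]).
Proof.
split=> A _ det_f.
  have coefE k : f@_k = gmd A k by rewrite det_f mcoeff_det_linear_pencil.
  by split=> *; rewrite coefE ?gmd_single ?gmd_full.
have coefE k : (f@_k)%:C = gmd A k.
  by rewrite -mcoeff_map_mpoly det_f mcoeff_det_linear_pencil.
by split=> *; rewrite coefE ?gmd_single ?gmd_full.
Qed.
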